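(* Let $n>d\ge 1$ and $m\ge 1$ be integers, let $A\in\mathbb{R}^{n\times d}$ be a fixed matrix of rank $d$ and let $y\in\mathbb{R}^n$ be a fixed vector. Let $x_{LS}=\arg\min_{x\in\mathbb{R}^d}\|Ax-y\|_2^2$ and $y^\perp=y-Ax_{LS}$, so that $A^Ty^\perp=0$. Let $S\in\mathbb{R}^{m\times n}$ be a random matrix with i.i.d. Gaussian entries of mean $0$ and variance $1/m$. Assume that $A^TS^TSA$ is invertible (with probability 1), and let $\widehat{x}=\arg\min_{x\in\mathbb{R}^d}\|SAx-Sy\|_2^2$. Then $$\widehat{x}=x_{LS}+(SA)^\dagger Sy^\perp,\qquad (SA)^\dagger=(A^TS^TSA)^{-1}A^TS^T .$$ Further, $Sy^\perp$ and each column of $SA$ are multivariate Gaussian random vectors, $Sy^\perp$ is independent of $SA$, and, conditionally on $SA$, the vector $\widehat{x}$ has the Gaussian distribution $$\widehat{x}\mid SA\ \sim\ \mathcal{N}\left(x_{LS},\ \frac{1}{m}\|y^\perp\|_2^2\,(A^TS^TSA)^{-1}\right).$$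
   Context: $\mathcal{N}(\mu,\Sigma)$ denotes the multivariate Gaussian distribution with mean $\mu$ and covariance matrix $\Sigma$; it is allowed to be degenerate (a point mass if $\Sigma=0$). The vector $\widehat{x}$ is called the classical Gaussian sketch solution, and $\|y^\perp\|_2^2$ the residual error. *)

(* Defs.v *)
From HB Require Import structures.
From mathcomp Require Import all_boot all_order all_algebra.
From mathcomp Require Import all_classical all_reals all_analysis.

Set Implicit Arguments.
Unset Strict Implicit.
Unset Printing Implicit Defensive.

Import Order.TTheory GRing.Theory Num.Theory.
Import numFieldNormedType.Exports.

Local Open Scope classical_set_scope.
Local Open Scope ring_scope.

Section matrix_borel.
Context (R : realType) (m n : nat).

(* The Borel sigma-algebra of R^(m x n), presented as the product
   sigma-algebra, i.e. the one generated by the coordinate maps. *)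
Definition mx_cylinders : set (set 'M[R]_(m, n)) :=
  \bigcup_(ij in [set: 'I_m * 'I_n])
    preimage_set_system setT (fun M : 'M[R]_(m, n) => M ij.1 ij.2) measurable.

Definition mx_measurable : set (set 'M[R]_(m, n)) := <<s mx_cylinders >>.

Let mx_measurable0 : mx_measurable set0.
Proof. exact: sigma_algebra0. Qed.

Let mx_measurableC A : mx_measurable A -> mx_measurable (~` A).
Proof. exact: sigma_algebraC. Qed.

Let mx_measurable_bigcup (F : (set 'M[R]_(m, n))^nat) :
  (forall i, mx_measurable (F i)) -> mx_measurable (\bigcup_i F i).
Proof. exact: sigma_algebra_bigcup. Qed.

HB.instance Definition _ := @isMeasurable.Build default_measure_display
  'M[R]_(m, n) mx_measurable mx_measurable0 mx_measurableC
  mx_measurable_bigcup.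

End matrix_borel.

(* The norm that the library puts on matrices is the sup norm, hence this
   squared Euclidean norm. *)
Definition normsq2 (R : realType) (k : nat) (v : 'cV[R]_k) : R :=
  \sum_(i < k) v i 0 ^+ 2.

Definition is_argmin (R : realType) (V : Type) (f : V -> R) (x : V) : Prop :=
  forall z, f x <= f z.

(* X is the Moore-Penrose inverse of the real matrix M (Penrose equations). *)
Definition is_moore_penrose (R : realType) (p q : nat)
    (M : 'M[R]_(p, q)) (X : 'M[R]_(q, p)) : Prop :=
  [/\ M *m X *m M = M, X *m M *m X = X,
      (M *m X)^T = M *m X & (X *m M)^T = X *m M].

(* N(mu, v) on the line, v >= 0 being the variance.  The case v = 0 has to be
   treated apart since normal_prob takes the standard deviation as argument and
   normal_prob mu 0 is the uniform law on [0, 1], not the point mass at mu. *)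
Definition normal_law (R : realType) (mu v : R) : set R -> \bar R :=
  if v == 0 then \d_mu else normal_prob mu (Num.sqrt v).

(* nu = N(mu, Sigma) on R^k, possibly degenerate: Sigma is symmetric positive
   semidefinite and every linear functional u^T has law
   N(u^T mu, u^T Sigma u) under nu. *)
Definition gaussian_law (R : realType) (k : nat)
    (mu : 'cV[R]_k) (Sigma : 'M[R]_k) (nu : set 'cV[R]_k -> \bar R) : Prop :=
  [/\ Sigma^T = Sigma,
      (forall u : 'cV[R]_k, 0 <= (u^T *m Sigma *m u) 0 0) &
      forall (u : 'cV[R]_k) (B : set R), measurable B ->
        nu [set x | B ((u^T *m x) 0 0)] =
        normal_law ((u^T *m mu) 0 0) ((u^T *m Sigma *m u) 0 0) B].

Section random_elements.
Context (R : realType) (d0 : measure_display) (T : measurableType d0)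
  (P : probability T R).

Definition gaussian_vector (k : nat) (Y : T -> 'cV[R]_k) : Prop :=
  measurable_fun setT Y /\
  exists (mu : 'cV[R]_k) (Sigma : 'M[R]_k),
    gaussian_law mu Sigma (pushforward P Y).

(* Since some of the B i may be the whole space, the product rule for the whole
   finite family yields the one for all its subfamilies. *)
Definition mutually_independent (I : finType) (d1 : measure_display)
    (U : measurableType d1) (X : I -> T -> U) : Prop :=
  forall B : I -> set U, (forall i, measurable (B i)) ->
    P (\bigcap_(i in [set: I]) (X i @^-1` B i)) =
    (\prod_(i : I) fine (P (X i @^-1` B i)))%:E.

Definition independent_pair (d1 d2 : measure_display) (U : measurableType d1)
    (V : measurableType d2) (X : T -> U) (Y : T -> V) : Prop :=
  forall (B : set U) (C : set V), measurable B -> measurable C ->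
    P (X @^-1` B `&` Y @^-1` C) = (P (X @^-1` B) * P (Y @^-1` C))%E.

(* k is a regular conditional distribution of Y given X. *)
Definition regular_cond_distribution (d1 d2 : measure_display)
    (U : measurableType d1) (V : measurableType d2)
    (Y : T -> V) (X : T -> U) (k : R.-pker U ~> V) : Prop :=
  forall (E : set U) (B : set V), measurable E -> measurable B ->
    P (X @^-1` E `&` Y @^-1` B) = (\int[P]_(w in X @^-1` E) k (X w) B)%E.

(* Y | X ~ N(mu, Sigma), where mu and Sigma may be random. *)
Definition cond_gaussian (d1 : measure_display) (U : measurableType d1)
    (k : nat) (Y : T -> 'cV[R]_k) (X : T -> U)
    (mu : T -> 'cV[R]_k) (Sigma : T -> 'M[R]_k) : Prop :=
  exists2 kappa : R.-pker U ~> 'cV[R]_k,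
    regular_cond_distribution Y X kappa &
    {ae P, forall w, gaussian_law (mu w) (Sigma w) (kappa (X w))}.

(* Entries i.i.d. N(0, v), for v > 0. *)
Definition iid_gaussian_entries (m n : nat) (S : T -> 'M[R]_(m, n)) (v : R) :
    Prop :=
  mutually_independent (fun (ij : 'I_m * 'I_n) w => S w ij.1 ij.2) /\
  forall (i : 'I_m) (j : 'I_n) (B : set R), measurable B ->
    P [set w | B (S w i j)] = normal_prob 0 (Num.sqrt v) B.

End random_elements.

Definition sketch_gram (R : realType) (m n d : nat)
    (S : 'M[R]_(m, n)) (A : 'M[R]_(n, d)) : 'M[R]_d :=
  A^T *m S^T *m S *m A.

(* (SA)^+ = (A^T S^T S A)^-1 A^T S^T *)
Definition sketch_pinv (R : realType) (m n d : nat)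
    (S : 'M[R]_(m, n)) (A : 'M[R]_(n, d)) : 'M[R]_(d, m) :=
  invmx (sketch_gram S A) *m A^T *m S^T.

(* Main.v *)
From HB Require Import structures.
Require Import Defs.
From mathcomp Require Import all_boot all_order all_algebra.
From mathcomp Require Import all_classical all_reals all_analysis.
From mathcomp Require Import measurable_realfun ring lra.

Set Implicit Arguments.
Unset Strict Implicit.
Unset Printing Implicit Defensive.

Import Order.TTheory GRing.Theory Num.Theory.
Import numFieldNormedType.Exports.

Local Open Scope classical_set_scope.
Local Open Scope ring_scope.

(** The deterministic claims are the normal equations.  If x minimises
    |M x - b|^2 then M^T (M x - b) = 0, because along x - t g with
    g = M^T (M x - b) the objective has derivative - 2 |g|^2 at t = 0.  For
    (A, y) this is A^T yperp = 0; for (S A, S y), with an invertible Gram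
    matrix, it determines xhat, and writing y = A xLS + yperp gives the
    formula.

    The probabilistic claims come from one property of the normal law: the
    product N(0, s^2) x N(0, s^2) is invariant under the rotations of the plane
    ([normal_prod_rotate]), since the density depends on x^2 + y^2 only and
    Lebesgue measure is rotation invariant.  Hence turning two members of a
    finite family of i.i.d. centred normal variables leaves the family i.i.d.
    ([iid_normal_rotate]).  A linear form sum_i a_i X_i is unchanged when
    (X_i) and (a_i) are turned together, and so are the scalar products of
    coefficient vectors; as in Givens elimination, such turns bring coefficient
    vectors to a simple shape ([eliminate]).  This replaces characteristic
    functions and multivariate densities.
    - One coefficient vector can be reduced to a single nonzero entry alpha,
      with alpha^2 = sum_i a_i^2, so that the form is normal of variance
      s^2 sum_i a_i^2 ([linear_form_law]).
    - Two mutually orthogonal systems of coefficient vectors can be brought to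
      disjoint supports ([split_orthogonal]); the corresponding forms are then
      functions of disjoint subfamilies, hence independent
      ([independent_orthogonal_forms]).

    The entries of S yperp and of S A are linear forms in the entries of S,
    and A^T yperp = 0 says that their coefficient vectors are orthogonal, so
    S yperp and S A are independent.  For independent X and Z, a conditional law
    of phi (X, Z) given X = x is the law of phi (x, Z)
    ([independent_regular_cond_distribution]).  With X = S A and Z = S yperp,
    phi (M, z) = xLS + (M^T M)^-1 M^T z is affine in z, so its law at a fixed M
    follows from [linear_form_law]: a functional u^T picks out the form with
    vector M (M^T M)^-1 u, whose squared norm is u^T (M^T M)^-1 u. *)

(** * Affine changes of variable and rotations of the plane *)

(** The instance making a pushforward a measure depends on a proof of
    measurability, which unification cannot guess; hence this packaging. *)
Definition image_measure (d1 d2 : measure_display) (T : measurableType d1)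
    (U : measurableType d2) (R : realFieldType)
    (m : {measure set T -> \bar R}) (f : T -> U) (mf : measurable_fun setT f) :
    {measure set U -> \bar R} :=
  measure_function_pushforward__canonical__measure_function_Measure m mf.

Section affine.
Context (R : realType).
Local Notation mu := (@lebesgue_measure R).

Lemma measurable_affine (a b : R) :
  measurable_fun setT (fun x : R => a * x + b).
Proof. by apply: measurable_funD => //; exact: measurable_funM. Qed.

Lemma preimage_affine_itv (a b p q : R) : a != 0 ->
  (fun x => a * x + b) @^-1` `]p, q]%classic =
  if 0 < a then `](p - b) / a, (q - b) / a]%classic
  else `[(q - b) / a, (p - b) / a[%classic.
Proof.
move=> a0; apply/seteqP; case: ltrP => [a_gt0|a_le0].
  split => x /=; rewrite !in_itv/= ltr_pdivrMr// ler_pdivlMr// mulrC;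
    by rewrite ltrBlDr lerBrDr.
have {a_le0}a_lt0 : a < 0 by rewrite lt_neqAle a0.
split => x /=; rewrite !in_itv/= ltr_ndivlMr// ler_ndivrMr// mulrC;
  by rewrite ltrBlDr lerBrDr andbC.
Qed.

(** Lebesgue measure is determined by its values on half-open intervals, and
    an affine map sends those to intervals of length multiplied by |a|. *)
Lemma lebesgue_measure_affine (a b : R) (A : set R) : a != 0 -> measurable A ->
  mu A = (`|a|%:E * mu ((fun x => a * x + b)%R @^-1` A))%E.
Proof.
move=> a0 mA.
pose f := (fun x => a * x + b) : measurableTypeR R -> measurableTypeR R.
have mf : measurable_fun setT f by exact: measurable_affine.
pose nu : {measure set (measurableTypeR R) -> \bar R} :=
  mscale (NngNum (normr_ge0 a)) (image_measure mu mf).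
apply: (@lebesgue_measure_unique R nu) => // X [[p q]] /= _ <-.
rewrite /mscale/= /pushforward/= preimage_affine_itv//.
have [a_gt0|a_le0] := ltP 0 a; rewrite !lebesgue_measure_itv/= !lte_fin.
  rewrite ltr_pM2r ?invr_gt0// ltrD2r.
  case: ifPn => [pq|]; last by rewrite mule0.
  by rewrite -!EFinB -EFinM gtr0_norm//; congr (_%:E); field.
have a_lt0 : a < 0 by rewrite lt_neqAle a0.
rewrite ltr_nM2r ?invr_lt0// ltrD2r.
case: ifPn => [pq|]; last by rewrite mule0.
by rewrite -!EFinB -EFinM ltr0_norm//; congr (_%:E); field.
Qed.

Lemma ge0_integral_affine (a b : R) (f : R -> \bar R) : a != 0 ->
  measurable_fun setT f -> (forall x, (0 <= f x)%E) ->
  (\int[mu]_x f x = `|a|%:E * \int[mu]_x f (a * x + b)%R)%E.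
Proof.
move=> a0 mf f0.
pose g := (fun x => a * x + b) : measurableTypeR R -> measurableTypeR R.
have mg : measurable_fun setT g by exact: measurable_affine.
pose nu := mscale (NngNum (normr_ge0 a)) (image_measure mu mg).
rewrite (@eq_measure_integral _ _ _ _ nu); last first.
  by move=> A mA _; exact: lebesgue_measure_affine.
by rewrite ge0_integral_mscale//= ge0_integral_pushforward.
Qed.

End affine.

Section density.
Local Open Scope ereal_scope.
Context (d : measure_display) (T : measurableType d) (R : realType).
Variables (mu nu : {measure set T -> \bar R}) (g : T -> R).
Hypotheses (mg : measurable_fun setT g) (g0 : forall x, (0 <= g x)%R).
Hypothesis nuE : forall A, measurable A -> nu A = \int[mu]_(x in A) (g x)%:E.

Import HBNNSimple.

Let integral_density_nnsfun (h : {nnsfun T >-> R}) :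
  \int[nu]_x (h x)%:E = \int[mu]_x ((h x)%:E * (g x)%:E).
Proof.
have mfib r : measurable (h @^-1` [set r]) by exact: measurable_funPTI.
transitivity (\sum_(r \in range h) r%:E * nu (h @^-1` [set r])).
  under eq_integral do rewrite fimfunE -fsumEFin//.
  rewrite ge0_integral_fsum//; last 2 first.
  - by move=> r; exact/measurable_EFinP/measurable_funM.
  - by move=> r x _; rewrite nnfun_muleindic_ge0.
  apply: eq_fsbigr => r _.
  by rewrite integralZl_indic_nnsfun// integral_indic// setIT.
transitivity (\int[mu]_x (\sum_(r \in range h)
    (r * \1_(h @^-1` [set r]) x)%:E * (g x)%:E)).
  rewrite ge0_integral_fsum//; last 2 first.
  - move=> r; apply: emeasurable_funM; last exact/measurable_EFinP.
    exact/measurable_EFinP/measurable_funM.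
  - by move=> r x _; rewrite mule_ge0 ?nnfun_muleindic_ge0 ?lee_fin.
  apply: eq_fsbigr => r /set_mem[x0 _ <-].
  rewrite nuE// integral_mkcond.
  rewrite -ge0_integralZl//; last 3 first.
  - apply: (measurable_restrictT _ (mfib _)).1; apply: measurable_funTS.
    exact/measurable_EFinP.
  - by move=> x _; rewrite patchE; case: ifP => // _; rewrite lee_fin.
  - by rewrite lee_fin.
  apply: eq_integral => x _; rewrite patchE indicE.
  by case: ifPn => _; rewrite ?mulr1// mulr0 mule0 mul0e.
apply: eq_integral => x _.
rewrite [in RHS]fimfunE -fsumEFin// ge0_mule_fsuml// => r.
exact: nnfun_muleindic_ge0.
Qed.

(** For simple functions this is the definition of a density; the general case
    is monotone convergence. *)
Lemma ge0_integral_density (f : T -> \bar R) :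
  measurable_fun setT f -> (forall x, 0 <= f x) ->
  \int[nu]_x f x = \int[mu]_x (f x * (g x)%:E).
Proof.
move=> mf f0; pose h := nnsfun_approx measurableT mf.
have h_cvg x : (h n x)%:E @[n --> \oo] --> f x by exact: cvg_nnsfun_approx.
transitivity (limn (fun n => \int[nu]_x (h n x)%:E)).
  rewrite -monotone_convergence//=.
  - by apply: eq_integral => x _; apply/esym/cvg_lim.
  - by move=> n; exact/measurable_EFinP.
  - by move=> n x _; rewrite lee_fin.
  - by move=> x _ a b ab; rewrite lee_fin; exact/lefP/nd_nnsfun_approx.
transitivity (limn (fun n => \int[mu]_x ((h n x)%:E * (g x)%:E))).
  by apply: congr_lim; apply/funext => n; exact: integral_density_nnsfun.
rewrite -monotone_convergence//=.
- apply: eq_integral => x _; apply/cvg_lim => //.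
  exact: cvgeZr.
- by move=> n; apply: emeasurable_funM => //; exact/measurable_EFinP.
- by move=> n x _; rewrite mule_ge0// lee_fin.
- move=> x _ a b ab; apply: lee_wpmul2r; rewrite lee_fin//.
  exact/lefP/nd_nnsfun_approx.
Qed.

End density.

Section rotation.
Context (R : realType).
Local Notation mu := (@lebesgue_measure R).

Lemma measurable_rotation (c s : R) :
  measurable_fun setT (fun z : R * R => (c * z.1 - s * z.2, s * z.1 + c * z.2)).
Proof.
apply: measurable_fun_pair.
  by apply: measurable_funB; exact: measurable_funM.
by apply: measurable_funD; exact: measurable_funM.
Qed.

(** By Tonelli's theorem one coordinate can be changed at a time.  For c != 0
    the affine substitution u = c x - s y in x turns s x + c y into
    (y + s u) / c at the cost of a factor 1 / |c|, which the substitution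
    v = (y + s u) / c in y cancels.  For c = 0 the rotation only exchanges the
    coordinates, up to sign. *)
Lemma ge0_integral_rotate (c s : R) (f : R * R -> \bar R) :
  c ^+ 2 + s ^+ 2 = 1 -> measurable_fun setT f -> (forall z, 0 <= f z)%E ->
  (\int[mu]_x \int[mu]_y f (c * x - s * y, s * x + c * y)%R =
   \int[mu]_x \int[mu]_y f (x, y))%E.
Proof.
move=> cs mf f0.
have mf2 u : measurable_fun setT (fun y => f (u, y)).
  by apply: (measurableT_comp mf); exact: measurable_fun_pair.
rewrite (@fubini_tonelli _ _ _ _ _ mu mu
  (fun z : R * R => f (c * z.1 - s * z.2, s * z.1 + c * z.2)%R)); last 2 first.
- apply: measurableT_comp => //; apply: measurable_fun_pair => //.
  by apply: measurable_funB; exact: measurable_funM.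
  by apply: measurable_funD; exact: measurable_funM.
- by move=> z; exact: f0.
rewrite /=; have [c0|c0] := eqVneq c 0.
  have s1 : `|s| = 1.
    apply/eqP; rewrite -sqrp_eq1// real_normK ?num_real//.
    by move: cs; rewrite c0 expr0n add0r => ->.
  have s0 : s != 0 by rewrite -normr_eq0 s1 oner_eq0.
  have Ns0 : - s != 0 by rewrite oppr_eq0.
  rewrite c0.
  have mF : measurable_fun setT (fun x => \int[mu]_y f (x, y))%E.
    exact: measurable_fun_fubini_tonelli_F.
  rewrite [RHS](ge0_integral_affine 0 Ns0)//; last first.
    by move=> x; exact: integral_ge0.
  rewrite normrN s1 mul1e; apply: eq_integral => y _.
  rewrite [RHS](ge0_integral_affine 0 s0)//.
  rewrite s1 mul1e; apply: eq_integral => x _.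
  by rewrite !mul0r add0r !addr0 mulNr.
(* The substitutions are carried out backwards, from the right-hand side. *)
rewrite [RHS](@eq_integral _ _ _ mu _ (fun u =>
    `|c^-1|%:E * \int[mu]_y f (u, c^-1 * y + c^-1 * s * u)%R)%E); last first.
  move=> u _.
  by rewrite [LHS](ge0_integral_affine (c^-1 * s * u) (invr_neq0 c0)).
pose g (z : R * R) := f (z.1, c^-1 * z.2 + c^-1 * s * z.1).
have g0 z : (0 <= g z)%E by exact: f0.
have mg : measurable_fun setT g.
  apply: measurableT_comp => //; apply: measurable_fun_pair => //.
  by apply: measurable_funD; exact: measurable_funM.
have mg1 : measurable_fun setT (fun x : R => \int[mu]_y g (x, y))%E.
  exact: measurable_fun_fubini_tonelli_F.
have mg2 : measurable_fun setT (fun y : R => \int[mu]_x g (x, y))%E.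
  exact: measurable_fun_fubini_tonelli_G.
rewrite [RHS]ge0_integralZl//; last by move=> x _; exact: integral_ge0.
rewrite [in RHS](@fubini_tonelli _ _ _ _ _ mu mu g)//=.
rewrite -ge0_integralZl//; last by move=> x _; exact: integral_ge0.
apply: eq_integral => y _.
rewrite [in RHS](ge0_integral_affine (- (s * y)) c0)//; last first.
  apply: (measurableT_comp mg) => //; exact: measurable_fun_pair.
rewrite muleA -EFinM -normrM mulVf// normr1 mul1e.
apply: eq_integral => x _; congr (f (_, _)).
have -> : c^-1 * y = c^-1 * ((c ^+ 2 + s ^+ 2) * y) by rewrite cs mul1r.
by rewrite /=; field.
Qed.

Lemma normal_pdf0_rotate (sigma c s x y : R) :
  sigma != 0 -> c ^+ 2 + s ^+ 2 = 1 ->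
  normal_pdf 0 sigma (c * x - s * y) * normal_pdf 0 sigma (s * x + c * y) =
  normal_pdf 0 sigma x * normal_pdf 0 sigma y.
Proof.
move=> s0 cs; rewrite /normal_pdf (negbTE s0) /normal_fun !subr0.
rewrite mulrACA [RHS]mulrACA; congr (_ * _); rewrite -!expRD; congr expR.
rewrite -!mulrDl -!opprD; congr (- _ * _).
by rewrite -[RHS]mul1r -cs; ring.
Qed.

Lemma normal_prodE (sigma : R) (C : set (R * R)) : measurable C ->
  ((normal_prob 0 sigma \x normal_prob 0 sigma) C =
   \int[mu]_x \int[mu]_y (\1_C (x, y) *
     (normal_pdf 0 sigma x * normal_pdf 0 sigma y))%:E)%E.
Proof.
move=> mC; set p := normal_pdf 0 sigma.
have mp : measurable_fun setT p by exact: measurable_normal_pdf.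
have p0 x : 0 <= p x by exact: normal_pdf_ge0.
rewrite /product_measure1 (ge0_integral_density (mu := mu) mp p0)//=.
  2: exact: measurable_fun_xsection.
apply: eq_integral => x _; rewrite /normal_prob integral_mkcond.
have mx : measurable (xsection C x) by exact: measurable_xsection.
rewrite -ge0_integralZr//; last 3 first.
- apply: (measurable_restrictT _ mx).1; apply: measurable_funTS.
  exact/measurable_EFinP.
- by move=> y _; rewrite patchE; case: ifP => // _; rewrite lee_fin.
- by rewrite lee_fin.
apply: eq_integral => y _; rewrite patchE indicE mem_xsection.
by case: ifPn => _; rewrite ?mul0r ?mul0e// mul1r -EFinM mulrC.
Qed.

Lemma normal_prod_rotate (sigma c s : R) (C : set (R * R)) :
  sigma != 0 -> c ^+ 2 + s ^+ 2 = 1 -> measurable C ->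
  ((normal_prob 0 sigma \x normal_prob 0 sigma)
     ((fun z => (c * z.1 - s * z.2, s * z.1 + c * z.2)%R) @^-1` C) =
   (normal_prob 0 sigma \x normal_prob 0 sigma) C)%E.
Proof.
move=> s0 cs mC; pose rot (z : R * R) := (c * z.1 - s * z.2, s * z.1 + c * z.2).
have mrot : measurable_fun setT rot by exact: measurable_rotation.
have mrC : measurable (rot @^-1` C) by rewrite -[_ @^-1` _]setTI; exact: mrot.
rewrite (normal_prodE _ mrC) (normal_prodE _ mC).
pose p := normal_pdf 0 sigma.
have mp : measurable_fun setT p by exact: measurable_normal_pdf.
have p0 x : 0 <= p x by exact: normal_pdf_ge0.
pose f (z : R * R) := (\1_C z * (p z.1 * p z.2))%:E.
have mf : measurable_fun setT f.
  apply/measurable_EFinP; apply: measurable_funM; first exact: measurable_indic.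
  by apply: measurable_funM; exact: measurableT_comp.
have f0 z : (0 <= f z)%E by rewrite lee_fin !mulr_ge0.
rewrite -[RHS](ge0_integral_rotate cs mf f0).
apply: eq_integral => x _; apply: eq_integral => y _.
congr (_ * _)%:E; exact/esym/normal_pdf0_rotate.
Qed.

Lemma normal_prob_affine (sigma a b : R) (B : set R) :
  sigma != 0 -> a != 0 -> measurable B ->
  normal_prob 0 sigma ((fun x => a * x + b) @^-1` B) =
  normal_prob b (`|a| * sigma) B.
Proof.
move=> s0 a0 mB.
have as0 : `|a| * sigma != 0 by rewrite mulf_neq0// normr_eq0.
have mpB : measurable ((fun x => a * x + b) @^-1` B).
  by rewrite -[_ @^-1` _]setTI; apply: measurable_affine.
pose g := (fun x => (normal_pdf b (`|a| * sigma) x)%:E) \_ B.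
have mg : measurable_fun setT g.
  apply: (measurable_restrictT _ mB).1; apply: measurable_funTS.
  by apply/measurable_EFinP; exact: measurable_normal_pdf.
have g0 x : (0 <= g x)%E.
  by rewrite /g patchE; case: ifP => // _; rewrite lee_fin normal_pdf_ge0.
have mga : measurable_fun setT (fun x => g (a * x + b)).
  by apply: (measurableT_comp mg); exact: measurable_affine.
rewrite /normal_prob [RHS]integral_mkcond [LHS]integral_mkcond -/g.
rewrite [RHS](ge0_integral_affine b a0 mg g0).
rewrite -ge0_integralZl//.
apply: eq_integral => x _; rewrite /g !patchE.
rewrite (_ : (x \in _ @^-1` B) = (a * x + b \in B)); last first.
  by apply/idP/idP; rewrite !inE.
case: ifP => _; last by rewrite mule0.
rewrite -EFinM; congr (_%:E); rewrite /normal_pdf (negbTE s0) (negbTE as0).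
rewrite mulrA; congr (_ * _).
  rewrite /normal_peak (_ : (`|a| * sigma) ^+ 2 * pi *+ 2 =
      a ^+ 2 * (sigma ^+ 2 * pi *+ 2)); last first.
    by rewrite exprMn real_normK ?num_real// mulrnAr mulrA.
  by rewrite sqrtrM ?sqr_ge0// sqrtr_sqr invfM mulVKf ?normr_eq0.
rewrite /normal_fun addrK subr0; congr expR.
have -> : (`|a| * sigma) ^+ 2 *+ 2 = a ^+ 2 * (sigma ^+ 2 *+ 2).
  by rewrite exprMn real_normK ?num_real// mulrnAr.
have -> : - (a * x) ^+ 2 = a ^+ 2 * - x ^+ 2 by rewrite exprMn mulrN.
by rewrite -mulf_div divff ?mul1r// sqrf_eq0.
Qed.

End rotation.

(** * Independent centred normal variables under rotations *)
Section product_law.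
Local Open Scope ereal_scope.
Context (d d1 d2 : measure_display) (T : measurableType d)
  (U : measurableType d1) (V : measurableType d2) (R : realType).
Variables (P : {measure set T -> \bar R}).
Variables (m1 : {sigma_finite_measure set U -> \bar R})
  (m2 : {sigma_finite_measure set V -> \bar R}).

(** Uniqueness of the product measure. The event E stands for a condition on
    further variables; it is the whole space when the law of the pair (X, Y)
    itself is wanted. *)
Lemma pair_law_product (X : T -> U) (Y : T -> V) (E : set T) :
  measurable_fun setT X -> measurable_fun setT Y -> measurable E ->
  (forall A B, measurable A -> measurable B ->
    P (X @^-1` A `&` Y @^-1` B `&` E) = m1 A * m2 B) ->
  forall C, measurable C ->
    P ((fun w => (X w, Y w)) @^-1` C `&` E) = (m1 \x m2) C.
Proof.
move=> mX mY mE XYE C mC.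
have mXY : measurable_fun setT (fun w => (X w, Y w)).
  exact: measurable_fun_pair.
pose nu := image_measure (mrestr P mE) mXY.
by rewrite (@product_measure_unique _ _ _ _ _ m1 m2 nu).
Qed.

Lemma product_measure1_mscale (r : {nonneg R}) (C : set (U * V)) :
  measurable C -> (mscale r m1 \x m2) C = r%:num%:E * (m1 \x m2) C.
Proof.
by move=> mC; apply: ge0_integral_mscale => //; exact: measurable_fun_xsection.
Qed.

End product_law.

Section iid_normal.
Context (R : realType) (d : measure_display) (T : measurableType d)
  (P : probability T R) (I : finType).
Implicit Types (X : I -> T -> R) (sigma : R).

(** Taking all but one B i to be the whole line gives the marginal laws, so
    this single product formula says both that the laws are N(0, sigma^2) and
    that the variables are mutually independent. *)
Definition iid_normal sigma X : Prop :=
  (forall i, measurable_fun setT (X i)) /\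
  forall B : I -> set R, (forall i, measurable (B i)) ->
    P (\bigcap_(i in [set: I]) (X i @^-1` B i)) =
    (\prod_(i : I) fine (normal_prob 0 sigma (B i)))%:E.

Definition rotate (c s : R) (k j : I) (f : I -> R) : I -> R :=
  fun i => if i == k then c * f k - s * f j
           else if i == j then s * f k + c * f j else f i.

(** On the event E that the remaining variables lie in given sets, (X k, X j)
    still has, up to the constant factor P(E), the rotation invariant law
    N(0, sigma^2) x N(0, sigma^2). *)
Lemma iid_normal_rotate sigma X (c s : R) (k j : I) :
  sigma != 0 -> c ^+ 2 + s ^+ 2 = 1 -> k != j -> iid_normal sigma X ->
  iid_normal sigma (fun i w => rotate c s k j (X ^~ w) i).
Proof.
move=> s0 cs kj [mX XP]; split.
  move=> i; rewrite /rotate; case: eqVneq => _.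
    by apply: measurable_funB; exact: measurable_funM.
  case: eqVneq => _ //.
  by apply: measurable_funD; exact: measurable_funM.
move=> B mB.
pose rest := [pred i | (i != k) && (i != j)].
have prod_split (F : I -> R) : \prod_i F i = F k * F j * \prod_(i | rest i) F i.
  by rewrite (bigD1 k)//= (bigD1 j)/= 1?eq_sym// mulrA.
pose E := \bigcap_(i in [set i | rest i]) (X i @^-1` B i).
have mE : measurable E.
  apply: fin_bigcap_measurable => [|i _]; first exact: finite_finset.
  by rewrite -[_ @^-1` _]setTI; exact: mX.
have r0 : 0 <= \prod_(i | rest i) fine (normal_prob 0 sigma (B i)).
  by apply: prodr_ge0 => i _; exact: fine_ge0.
have XE (B1 B2 : set R) : measurable B1 -> measurable B2 ->
    P (X k @^-1` B1 `&` X j @^-1` B2 `&` E) =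
    (mscale (NngNum r0) (normal_prob 0 sigma) B1 * normal_prob 0 sigma B2)%E.
  move=> mB1 mB2.
  pose B' i := if i == k then B1 else if i == j then B2 else B i.
  have mB' i : measurable (B' i) by rewrite /B'; case: ifP => // _; case: ifP.
  rewrite (_ : _ `&` _ `&` _ = \bigcap_(i in [set: I]) (X i @^-1` B' i)).
  2: {
    apply/seteqP; split => w /=.
      move=> [[w1 w2] w3] i _; rewrite /B' /=.
      case: (eqVneq i k) => [->//|ik]; case: (eqVneq i j) => [->//|ij].
      by apply: (w3 i); rewrite /= ik ij.
    move=> wB'; split; first split.
    - by have := wB' k Logic.I; rewrite /B'/= eqxx.
    - by have := wB' j Logic.I; rewrite /B'/= eqxx eq_sym (negbTE kj).
    - move=> i /andP[ik ij]; have := wB' i Logic.I.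
      by rewrite /B'/= (negbTE ik) (negbTE ij).
  }
  rewrite XP// prod_split /B' eqxx [j == k]eq_sym (negbTE kj) eqxx.
  rewrite /mscale/=.
  rewrite -[in RHS](fineK (fin_num_measure (normal_prob 0 sigma) B1 mB1)).
  rewrite -[in RHS](fineK (fin_num_measure (normal_prob 0 sigma) B2 mB2)).
  rewrite -!EFinM; congr (_%:E); rewrite mulrC mulrA; congr (_ * _ * _).
  by apply: eq_bigr => i /andP[/negbTE -> /negbTE ->].
pose rot (z : R * R) := (c * z.1 - s * z.2, s * z.1 + c * z.2).
have mrot : measurable_fun setT rot by exact: measurable_rotation.
have mBB : measurable (B k `*` B j) by exact: measurableX.
have mrB : measurable (rot @^-1` (B k `*` B j)).
  by rewrite -[_ @^-1` _]setTI; exact: mrot.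
rewrite (_ : \bigcap_(i in _) _ =
    (fun w => (X k w, X j w)) @^-1` (rot @^-1` (B k `*` B j)) `&` E);
  last first.
  apply/seteqP; split => w /=.
    move=> wB; split.
      split; first by have := wB k Logic.I; rewrite /rotate /= eqxx.
      by have := wB j Logic.I; rewrite /rotate/= eq_sym (negbTE kj) eqxx.
    move=> i /andP[ik ij]; have := wB i Logic.I.
    by rewrite /rotate/= (negbTE ik) (negbTE ij).
  move=> [[/= wk wj] wE] i _; rewrite /rotate /=.
  case: (eqVneq i k) => [->//|ik]; case: (eqVneq i j) => [->//|ij].
  by apply: (wE i); rewrite /= ik ij.
pose N : probability (measurableTypeR R) R := normal_prob 0 sigma.
have NE := pair_law_product (m1 := mscale (NngNum r0) N) (m2 := N)
  (mX k) (mX j) mE XE.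
rewrite {}NE//.
rewrite (product_measure1_mscale N N (NngNum r0) mrB).
rewrite (normal_prod_rotate s0 cs mBB).
rewrite product_measure1E; [|exact: mB|exact: mB].
rewrite prod_split mulrC !EFinM.
have NBE i : N (B i) = (fine (N (B i)))%:E.
  by rewrite fineK // fin_num_measure //; exact: mB.
by congr (_ * (_ * _))%E; exact: NBE.
Qed.

End iid_normal.

(** * Elimination of coefficients by rotations *)
Section elimination.
Context (R : realType) (d : measure_display) (T : measurableType d)
  (P : probability T R) (I : finType).
Implicit Types (X : I -> T -> R) (sigma : R).

Lemma dot_rotate (c s : R) (k j : I) (f g : I -> R) :
  c ^+ 2 + s ^+ 2 = 1 -> k != j ->
  \sum_i rotate c s k j f i * rotate c s k j g i = \sum_i f i * g i.
Proof.
move=> cs kj; rewrite (bigD1 k)//= (bigD1 j)/= 1?eq_sym//.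
rewrite [RHS](bigD1 k)//= [in RHS](bigD1 j)/= 1?eq_sym//.
rewrite !addrA; congr (_ + _); last first.
  by apply: eq_bigr => i /andP[/negbTE ik /negbTE ij]; rewrite /rotate ik ij.
rewrite /rotate !eqxx [j == k]eq_sym (negbTE kj).
rewrite -[f k * g k]mul1r -[f j * g j]mul1r -cs; ring.
Qed.

Section orthogonal_change.
Context (K : Type) (U : {set I}).

(** An orthogonal change of coordinates, recorded by what it preserves. The
    coefficient vectors indexed by K are transformed simultaneously, and U is
    the set of coordinates among which the rotations take place. *)
Definition orthogonal_change (sigma : R) X (a : K -> I -> R)
    X' (a' : K -> I -> R) :=
  [/\ iid_normal P sigma X',
      forall t w, \sum_i a' t i * X' i w = \sum_i a t i * X i w,
      forall t u, \sum_i a' t i * a' u i = \sum_i a t i * a u i &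
      forall t i, i \notin U -> a' t i = a t i].

Lemma orthogonal_change_trans sigma X a X1 a1 X2 a2 :
  orthogonal_change sigma X a X1 a1 -> orthogonal_change sigma X1 a1 X2 a2 ->
  orthogonal_change sigma X a X2 a2.
Proof.
move=> [_ l1 d1 u1] [i2 l2 d2 u2]; split => //.
- by move=> t w; rewrite l2.
- by move=> t u; rewrite d2.
- by move=> t i iU; rewrite u2// u1.
Qed.

Lemma orthogonal_change_rotate sigma X a (c s : R) (k j : I) :
  sigma != 0 -> c ^+ 2 + s ^+ 2 = 1 -> k != j -> k \in U -> j \in U ->
  iid_normal P sigma X ->
  orthogonal_change sigma X a (fun i w => rotate c s k j (X ^~ w) i)
    (fun t => rotate c s k j (a t)).
Proof.
move=> s0 cs kj kU jU iX; split.
- exact: iid_normal_rotate.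
- by move=> t w; exact: dot_rotate.
- by move=> t u; exact: dot_rotate.
- move=> t i iU; rewrite /rotate.
  have [ik|ik] := eqVneq i k; first by rewrite -ik (negbTE iU) in kU.
  by have [ij|//] := eqVneq i j; rewrite -ij (negbTE iU) in jU.
Qed.

(** Turning coordinates k and j by the angle that sends (a k, a j) to (r, 0)
    removes the coefficient at j and keeps the one at k nonzero; induction is
    on the number of coefficients still to be removed. *)
Lemma eliminate sigma X (a : K -> I -> R) (t : K) (k : I) :
  sigma != 0 -> k \in U -> a t k != 0 -> iid_normal P sigma X ->
  exists X' a', [/\ orthogonal_change sigma X a X' a', a' t k != 0 &
    forall i, i \in U -> i != k -> a' t i = 0].
Proof.
move=> s0 kU + iX.
pose bad (a : K -> I -> R) := [set i in U | (i != k) && (a t i != 0)].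
have [n] := ubnP #|bad a|; elim: n X a iX => // n IHn X a iX badn ak0.
have [bad0|[j]] := set_0Vmem (bad a).
  exists X, a; split => // i iU ik; apply/eqP; apply: contraT => ai.
  by have := finset.in_set0 i; rewrite -bad0 inE iU ik ai.
rewrite inE => /and3P[jU jk aj].
pose r := Num.sqrt (a t k ^+ 2 + a t j ^+ 2).
have r2 : r ^+ 2 = a t k ^+ 2 + a t j ^+ 2.
  by rewrite sqr_sqrtr// addr_ge0// sqr_ge0.
have r0 : r != 0.
  by rewrite sqrtr_eq0 -ltNge ltr_wpDr ?sqr_ge0// exprn_even_gt0.
pose c := a t k / r; pose s := - (a t j / r).
have cs : c ^+ 2 + s ^+ 2 = 1.
  by rewrite /c /s sqrrN !expr_div_n -mulrDl -r2 divff// sqrf_eq0.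
have kj : k != j by rewrite eq_sym.
have /= XX1 := @orthogonal_change_rotate sigma X a c s k j s0 cs kj kU jU iX.
set X1 := (fun i w => _) in XX1; set a1 := (fun t => _) in XX1.
(* The entry at k becomes (a_k^2 + a_j^2) / r, that is, r. *)
have a1k : a1 t k != 0.
  rewrite /a1 /rotate eqxx (_ : _ - _ = r)//.
  by apply: (mulIf r0); rewrite -expr2 r2 /c /s; field.
have a1j : a1 t j = 0.
  by rewrite /a1 /rotate (negbTE jk) eqxx /c /s; field.
have [iX1 _ _ _] := XX1.
have bad1n : (#|bad a1| < n)%N.
  rewrite -ltnS (leq_trans _ badn)// ltnS; apply: proper_card.
  apply/properP; split; last first.
    by exists j; rewrite !inE ?jU ?jk ?aj// a1j eqxx !andbF.
  apply/fintype.subsetP => i; rewrite !inE => /and3P[-> ik].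
  rewrite ik /= {1}/a1 /rotate (negbTE ik); case: (eqVneq i j) => // ->.
  by move: a1j; rewrite /a1 /rotate (negbTE jk) eqxx => ->; rewrite eqxx.
have [X2 [a2 [XX2 a2k a2U]]] := IHn X1 a1 iX1 bad1n a1k.
by exists X2, a2; split => //; exact: orthogonal_change_trans XX2.
Qed.

End orthogonal_change.

Lemma iid_normal_marginal sigma X (k : I) (B : set R) :
  iid_normal P sigma X -> measurable B ->
  P (X k @^-1` B) = normal_prob 0 sigma B.
Proof.
move=> [mX XP] mB; pose B' i := if i == k then B else setT.
have mB' i : measurable (B' i) by rewrite /B'; case: ifP.
rewrite (_ : _ @^-1` _ = \bigcap_(i in [set: I]) (X i @^-1` B' i)); last first.
  apply/seteqP; split => w /=; last first.
    by move=> /(_ k Logic.I); rewrite /B'/= eqxx.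
  by move=> Bw i _; rewrite /B' /=; case: (eqVneq i k) => [->|].
rewrite XP// (bigD1 k)//= big1 => [|i ik].
  rewrite mulr1 /B' eqxx fineK// fin_num_measure//; exact: mB.
by rewrite /B' (negbTE ik) [X in fine X]probability_setT.
Qed.

(** After elimination only one coefficient alpha is left, and alpha^2 = sum_i
    a_i^2 because scalar products are preserved: the form is an affine
    function of a single normal variable. When all coefficients vanish it is
    constant, which is the degenerate case of [normal_law]. *)
Lemma linear_form_law (v : R) X (a : I -> R) (b : R) (B : set R) :
  0 < v -> iid_normal P (Num.sqrt v) X -> measurable B ->
  P [set w | B (b + \sum_i a i * X i w)] =
  normal_law b (v * \sum_i a i ^+ 2) B.
Proof.
move=> v0 iX mB; have s0 : Num.sqrt v != 0 by rewrite sqrtr_eq0 -ltNge.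
rewrite /normal_law mulf_eq0 (gt_eqF v0)/=.
case: ifPn => [/eqP|].
  move=> /psumr_eq0P => a0.
  rewrite (_ : [set _ | _] = [set w | B b]); last first.
    apply/funext => w /=; rewrite big1 ?addr0// => i _.
    have /eqP := a0 (fun i _ => sqr_ge0 (a i)) i erefl.
    by rewrite sqrf_eq0 => /eqP ->; rewrite mul0r.
  rewrite diracE; have [bB|bB] := pselect (B b).
    rewrite mem_set// (_ : [set _ | _] = setT) ?probability_setT//.
    by apply/seteqP; split.
  rewrite memNset// (_ : [set _ | _] = set0) ?measure0//.
  by apply/seteqP; split.
rewrite psumr_neq0 => [|i _]; last exact: sqr_ge0.
move=> /hasP[k _ /=]; rewrite exprn_even_gt0//= => ak.
have [X' [a' [[iX' form' dot' _] _ a'0]]] :=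
  @eliminate unit [set: I]%SET _ X (fun _ => a) tt k s0
    (finset.in_setT _) ak iX.
have a'sum (F : I -> R) : \sum_i a' tt i * F i = a' tt k * F k.
  rewrite (bigD1 k)//= big1 ?addr0// => i ik.
  by rewrite a'0 ?finset.in_setT// mul0r.
have a2 : a' tt k ^+ 2 = \sum_i a i ^+ 2.
  by have := dot' tt tt; rewrite a'sum -expr2.
have a'k : a' tt k != 0.
  rewrite -sqrf_eq0 a2 psumr_neq0 => [|i _]; last exact: sqr_ge0.
  by apply/hasP; exists k; rewrite ?mem_index_enum//= exprn_even_gt0.
pose h x := a' tt k * x + b.
rewrite (_ : [set _ | _] = X' k @^-1` (h @^-1` B)); last first.
  by apply/funext => w; rewrite /h /= -(a'sum (X' ^~ w)) (form' tt w) addrC.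
have mhB : measurable (h @^-1` B).
  by rewrite -[_ @^-1` _]setTI; apply: measurable_affine.
rewrite (iid_normal_marginal k iX' mhB) (normal_prob_affine b s0 a'k mB) -a2.
by rewrite (sqrtrM _ (ltW v0)) sqrtr_sqr [X in normal_prob b X]mulrC.
Qed.

(** J collects coordinates on which all vectors of the second system vanish.
    If some vector v of the first system is nonzero outside J, the rotations
    among the coordinates outside J leave it with one nonzero coordinate i
    there. A vector u of the second system then satisfies 0 = sum_x v_x u_x =
    v_i u_i, so i can be added to J. Once this stops, the first system
    vanishes outside J. *)
Lemma split_orthogonal (K L : Type) sigma X (c : K + L -> I -> R) :
  sigma != 0 -> iid_normal P sigma X ->
  (forall k l, \sum_i c (inl k) i * c (inr l) i = 0) ->
  exists X' c' (J : {set I}), [/\ iid_normal P sigma X',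
    forall t w, \sum_i c' t i * X' i w = \sum_i c t i * X i w,
    forall k i, i \notin J -> c' (inl k) i = 0 &
    forall l i, i \in J -> c' (inr l) i = 0].
Proof.
move=> s0 iX orth.
suff loop n X1 (c1 : K + L -> I -> R) (J : {set I}) : (#|~: J| < n)%N ->
    iid_normal P sigma X1 ->
    (forall k l, \sum_i c1 (inl k) i * c1 (inr l) i = 0) ->
    (forall l i, i \in J -> c1 (inr l) i = 0) ->
    exists X' c' (J : {set I}), [/\ iid_normal P sigma X',
      forall t w, \sum_i c' t i * X' i w = \sum_i c1 t i * X1 i w,
      forall k i, i \notin J -> c' (inl k) i = 0 &
      forall l i, i \in J -> c' (inr l) i = 0].
  apply: (loop #|~: finset.set0|.+1 X c finset.set0) => // l i.
  by rewrite finset.in_set0.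
elim: n X1 c1 J => // n IHn X1 c1 J Jn iX1 orth1 c1J.
have [[k [i [iJ cki]]]|done_] :=
    pselect (exists k i, i \notin J /\ c1 (inl k) i != 0); last first.
  exists X1, c1, J; split => // k i iJ; apply/eqP.
  apply: contra_notT done_ => cki.
  by exists k, i.
have iU : i \in ~: J by rewrite inE.
have [X2 [c2 [[iX2 form2 dot2 off2] c2ki c2k0]]] :=
  eliminate s0 iU cki iX1.
have c2J l x : x \in J -> c2 (inr l) x = 0.
  by move=> xJ; rewrite off2 ?c1J// inE negbK.
have orth2 k' l' : \sum_i c2 (inl k') i * c2 (inr l') i = 0 by rewrite dot2.
have c2i l : c2 (inr l) i = 0.
  have := orth2 k l; rewrite (bigD1 i)//= big1 ?addr0 => [|x xi].
    by move/eqP; rewrite mulf_eq0 (negbTE c2ki)/= => /eqP.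
  have [xJ|xJ] := boolP (x \in J); first by rewrite c2J// mulr0.
  by rewrite c2k0 ?mul0r// inE.
have [||||X' [c' [J' [iX' form' c'l c'r]]]] := IHn X2 c2 (i |: J).
- rewrite -ltnS (leq_trans _ Jn)// ltnS; apply: proper_card.
  apply/properP; split; last by exists i; rewrite ?inE ?eqxx.
  by apply/fintype.subsetP => x; rewrite !inE negb_or => /andP[].
- exact: iX2.
- exact: orth2.
- by move=> l x; rewrite !inE => /orP[/eqP ->|]; [exact: c2i|exact: c2J].
by exists X', c', J'; split => // t w; rewrite form' form2.
Qed.

End elimination.

(** * Measurability of matrix operations *)
Section measurable_matrices.
Context (R : realType).

Lemma measurable_mx_entry (m n : nat) (i : 'I_m) (j : 'I_n) :
  measurable_fun setT (fun M : 'M[R]_(m, n) => M i j).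
Proof.
move=> _ B mB; rewrite setTI; apply: sub_sigma_algebra.
by exists (i, j) => //; exists B; rewrite ?setTI.
Qed.

Definition mx_box (m n : nat) (B : 'I_m -> 'I_n -> set R) : set 'M[R]_(m, n) :=
  [set M | forall i j, B i j (M i j)].

(** Unlike the cylinders over a single entry, the boxes form a pi-system. *)
Definition mx_boxes (m n : nat) : set (set 'M[R]_(m, n)) :=
  [set mx_box B | B in [set B | forall i j, measurable (B i j)]].

Lemma measurable_mx_box (m n : nat) (B : 'I_m -> 'I_n -> set R) :
  (forall i j, measurable (B i j)) -> measurable (mx_box B).
Proof.
move=> mB; rewrite (_ : mx_box B = \bigcap_(ij in [set: 'I_m * 'I_n])
    ((fun M : 'M[R]_(m, n) => M ij.1 ij.2) @^-1` B ij.1 ij.2)); last first.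
  apply/seteqP; split => M /=; first by move=> MB [i j] _; exact: MB.
  by move=> MB i j; exact: (MB (i, j)).
apply: fin_bigcap_measurable => [|ij _]; first exact: finite_finset.
by rewrite -[_ @^-1` _]setTI; apply: measurable_mx_entry.
Qed.

Lemma mx_measurableE (m n : nat) :
  @measurable _ 'M[R]_(m, n) = <<s @mx_boxes m n >>.
Proof.
apply/seteqP; split.
  apply: smallest_sub; first exact: smallest_sigma_algebra.
  move=> _ [[i0 j0] _ [B mB <-]]; rewrite setTI; apply: sub_sigma_algebra.
  exists (fun i j => if (i, j) == (i0, j0) then B else setT).
    by move=> i j; case: ifP.
  apply/seteqP; split => M /=; first by move=> /(_ i0 j0); rewrite eqxx.
  by move=> MB i j; case: eqVneq => // -[-> ->].
apply: smallest_sub; first exact: sigma_algebra_measurable.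
by move=> _ [B mB <-]; exact: measurable_mx_box.
Qed.

Lemma setI_closed_mx_boxes (m n : nat) : setI_closed (@mx_boxes m n).
Proof.
move=> _ _ [B mB <-] [C mC <-]; exists (fun i j => B i j `&` C i j).
  by move=> i j; exact: measurableI.
apply/seteqP; split => M /=; last by move=> [MB MC] i j; split.
by move=> MBC; split => i j; have [] := MBC i j.
Qed.

Lemma mx_boxesT (m n : nat) : @mx_boxes m n setT.
Proof. by exists (fun _ _ => setT) => //; apply/seteqP; split. Qed.

(** The inverse is continuous off 0, and every function is measurable on a
    singleton. *)
Lemma measurable_inv : measurable_fun setT (@GRing.inv R).
Proof.
rewrite -(setvU [set 0]) measurable_funU//.
- split; last exact: measurable_fun_set1.
  apply: open_continuous_measurable_fun.
    by rewrite openC; exact: closed_eq.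
  by move=> x /set_mem/eqP x0; exact: inv_continuous.
- exact: measurableC.
Qed.

Context (d : measure_display) (T : measurableType d).

Lemma measurable_mx (m n : nat) (f : T -> 'M[R]_(m, n)) :
  (forall i j, measurable_fun setT (fun w => f w i j)) -> measurable_fun setT f.
Proof.
move=> mf; apply: (measurability _ (mx_measurableE m n)) => _ [_ [B mB <-] <-].
rewrite (_ : _ `&` _ = \bigcap_(ij in [set: 'I_m * 'I_n])
    ((fun w => f w ij.1 ij.2) @^-1` B ij.1 ij.2)); last first.
  apply/seteqP; split => M /=; first by move=> [_ MB] [i j] _; exact: MB.
  by move=> MB; split => // i j; exact: (MB (i, j)).
apply: fin_bigcap_measurable => [|ij _]; first exact: finite_finset.
by rewrite -[_ @^-1` _]setTI; apply: mf.
Qed.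

Lemma measurable_entry (m n : nat) (f : T -> 'M[R]_(m, n)) i j :
  measurable_fun setT f -> measurable_fun setT (fun w => f w i j).
Proof. by move=> mf; apply: (measurableT_comp (measurable_mx_entry i j)). Qed.

Lemma measurable_mulmx (m n p : nat)
    (f : T -> 'M[R]_(m, n)) (g : T -> 'M[R]_(n, p)) :
  measurable_fun setT f -> measurable_fun setT g ->
  measurable_fun setT (fun w => f w *m g w).
Proof.
move=> mf mg; apply: measurable_mx => i j; under eq_fun do rewrite mxE.
by apply: measurable_sum => k; apply: measurable_funM; exact: measurable_entry.
Qed.

Lemma measurable_trmx (m n : nat) (f : T -> 'M[R]_(m, n)) :
  measurable_fun setT f -> measurable_fun setT (fun w => (f w)^T).
Proof.
move=> mf; apply: measurable_mx => i j; under eq_fun do rewrite mxE.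
exact: measurable_entry.
Qed.

Lemma measurable_det (n : nat) (f : T -> 'M[R]_n) :
  measurable_fun setT f -> measurable_fun setT (fun w => \det (f w)).
Proof.
move=> mf; apply: measurable_sum => s; apply: measurable_funM => //.
by apply: measurable_prod => i _; exact: measurable_entry.
Qed.

Lemma measurable_adj (n : nat) (f : T -> 'M[R]_n) :
  measurable_fun setT f -> measurable_fun setT (fun w => \adj (f w)).
Proof.
move=> mf; apply: measurable_mx => i j; under eq_fun do rewrite mxE.
apply: measurable_funM => //; apply: measurable_det.
apply: measurable_mx => k l; under eq_fun do rewrite !mxE.
exact: measurable_entry.
Qed.

End measurable_matrices.

(** * Independence of orthogonal linear images *)
Section independence.
Context (R : realType) (d : measure_display) (T : measurableType d)
  (P : probability T R).

Section pi_systems.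
Context (d1 d2 : measure_display) (U : measurableType d1)
  (V : measurableType d2) (X : T -> U) (Y : T -> V).
Variables (G : set (set U)) (H : set (set V)).
Hypotheses (mX : measurable_fun setT X) (mY : measurable_fun setT Y).
Hypotheses (UG : @measurable _ U = <<s G >>) (VH : @measurable _ V = <<s H >>).
Hypotheses (GI : setI_closed G) (HI : setI_closed H).
Hypotheses (GT : G setT) (HT : H setT).

(** Two applications of the pi-lambda theorem: with A in G fixed, both sides
    are finite measures in B, so the rule extends to all measurable B; then
    with B fixed it extends to all measurable A. *)
Lemma independent_pair_generators :
  (forall A B, G A -> H B ->
    P (X @^-1` A `&` Y @^-1` B) = (P (X @^-1` A) * P (Y @^-1` B))%E) ->
  independent_pair P X Y.
Proof.
move=> GH.
have mG A : G A -> measurable A by rewrite UG; exact: sub_sigma_algebra.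
have mXA A : measurable A -> measurable (X @^-1` A).
  by move=> mA; rewrite -[_ @^-1` _]setTI; exact: mX.
have mYB B : measurable B -> measurable (Y @^-1` B).
  by move=> mB; rewrite -[_ @^-1` _]setTI; exact: mY.
have fin_scale (E : set T) : measurable E -> {r : {nonneg R} | P E = r%:num%:E}.
  move=> mE; have r0 : 0 <= fine (P E) by exact: fine_ge0.
  by exists (NngNum r0); rewrite /= fineK// fin_num_measure.
have GY A B : G A -> measurable B ->
    P (X @^-1` A `&` Y @^-1` B) = (P (X @^-1` A) * P (Y @^-1` B))%E.
  move=> GA mB; have [r rE] := fin_scale _ (mXA _ (mG _ GA)).
  pose m1 := image_measure (mrestr P (mXA _ (mG _ GA))) mY.
  pose m2 := mscale r (image_measure P mY).
  have m12 : m1 B = m2 B.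
    apply: (measure_unique H (fun=> setT)) => //.
    - by rewrite bigcup_const.
    - move=> B' HB'; rewrite /m1 /m2 /= /mrestr /mscale /= /pushforward.
      by rewrite -rE setIC GH.
    - move=> _; rewrite (le_lt_trans (probability_le1 P _)) ?ltry//.
      by apply: measurableI; [exact: (mYB _ _)|exact: (mXA _ (mG _ _))].
  by move: m12; rewrite /m1 /m2 /= /mrestr /mscale /= /pushforward -rE setIC.
move=> A B mA mB; have [r rE] := fin_scale _ (mYB _ mB).
pose m1 := image_measure (mrestr P (mYB _ mB)) mX.
pose m2 := mscale r (image_measure P mX).
have m12 : m1 A = m2 A.
  apply: (measure_unique G (fun=> setT)) => //.
  - by rewrite bigcup_const.
  - move=> A' GA'; rewrite /m1 /m2 /= /mrestr /mscale /= /pushforward.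
    by rewrite -rE GY// muleC.
  - move=> _; rewrite (le_lt_trans (probability_le1 P _)) ?ltry//.
    by apply: measurableI; [exact: (mXA _ _)|exact: (mYB _ _)].
by move: m12; rewrite /m1 /m2 /= /mrestr /mscale /= /pushforward -rE muleC.
Qed.

End pi_systems.

Lemma independent_pair_comp (d1 d2 d3 d4 : measure_display)
    (U : measurableType d1) (V : measurableType d2)
    (U' : measurableType d3) (V' : measurableType d4)
    (X : T -> U) (Y : T -> V) (f : U -> U') (g : V -> V') :
  measurable_fun setT f -> measurable_fun setT g ->
  independent_pair P X Y -> independent_pair P (f \o X) (g \o Y).
Proof.
move=> mf mg XY B C mB mC; apply: (XY (f @^-1` B) (g @^-1` C)).
  by rewrite -[_ @^-1` _]setTI; exact: mf.
by rewrite -[_ @^-1` _]setTI; exact: mg.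
Qed.

Section masks.
Context (m n : nat) (sigma : R) (X : 'I_m * 'I_n -> T -> R).
Hypothesis iX : iid_normal P sigma X.

(** The subfamily of X indexed by J, kept in the full matrix format (with
    zeros outside J) so that a subfamily and its complement have the same
    type. *)
Definition mask (J : {set 'I_m * 'I_n}) (w : T) : 'M[R]_(m, n) :=
  \matrix_(i, j) (if (i, j) \in J then X (i, j) w else 0).

Lemma measurable_mask J : measurable_fun setT (mask J).
Proof.
have [mX _] := iX; apply: measurable_mx => i j.
under eq_fun do rewrite /mask mxE.
by case: ((i, j) \in J); [exact: mX|exact: measurable_cst].
Qed.

Lemma mask_box J (B : 'I_m -> 'I_n -> set R) :
  mask J @^-1` mx_box B = \bigcap_(ij in [set: 'I_m * 'I_n])
    (X ij @^-1` [set x | B ij.1 ij.2 (if ij \in J then x else 0)]).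
Proof.
apply/seteqP; split => w /=.
  by move=> wB [i j] _; have := wB i j; rewrite mxE.
by move=> wB i j; rewrite mxE; exact: (wB (i, j)).
Qed.

(** On boxes both sides are products over all the entries. At each entry one
    of the two masks is constantly 0, so its constraint is either void or
    impossible, and the product rule holds factor by factor. *)
Lemma independent_masks J : independent_pair P (mask J) (mask (~: J)).
Proof.
have [mX XP] := iX.
apply: (independent_pair_generators (measurable_mask J) (measurable_mask _)
  (mx_measurableE R m n) (mx_measurableE R m n) (@setI_closed_mx_boxes R m n)
  (@setI_closed_mx_boxes R m n) (mx_boxesT R m n) (mx_boxesT R m n)).
move=> _ _ [B mB <-] [C mC <-]; rewrite !mask_box.
pose D (B : 'I_m -> 'I_n -> set R) (K : {set 'I_m * 'I_n}) ij :=
  [set x | B ij.1 ij.2 (if ij \in K then x else 0)].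
have mD (B' : 'I_m -> 'I_n -> set R) K ij :
    (forall i j, measurable (B' i j)) -> measurable (D B' K ij).
  move=> mB'; rewrite /D; case: (ij \in K); first exact: mB'.
  by have [b|b] := pselect (B' ij.1 ij.2 0);
    [rewrite (_ : [set _ | _] = setT)|rewrite (_ : [set _ | _] = set0)] => //;
    apply/seteqP; split.
rewrite (_ : _ `&` _ = \bigcap_(ij in [set: 'I_m * 'I_n])
    (X ij @^-1` (D B J ij `&` D C (~: J) ij))); last first.
  apply/seteqP; split => w /=.
    by move=> [wB wC] ij _; split; [exact: wB|exact: wC].
  by move=> wBC; split => ij _; have [] := wBC ij Logic.I.
rewrite !XP; [|by move=> ij; exact: mD|by move=> ij; exact: mD|];
  last by move=> ij; apply: measurableI; exact: mD.
rewrite -EFinM -big_split/=; congr (_%:E); apply: eq_bigr => ij _.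
rewrite -/(D B J ij) -/(D C (~: J)%SET ij).
have triv (B' : 'I_m -> 'I_n -> set R) (K : {set 'I_m * 'I_n}) : ij \notin K ->
    D B' K ij = setT \/ D B' K ij = set0.
  move=> /negbTE ijK; rewrite /D ijK; have [b|b] := pselect (B' ij.1 ij.2 0).
    by left; apply/seteqP; split.
  by right; apply/seteqP; split.
have key (E F : set R) : F = setT \/ F = set0 ->
    fine (normal_prob 0 sigma (E `&` F)) =
    fine (normal_prob 0 sigma E) * fine (normal_prob 0 sigma F).
  case=> ->; first by rewrite setIT [X in _ * fine X]probability_setT mulr1.
  by rewrite setI0 [X in _ * fine X]measure0 mulr0 [X in fine X]measure0.
have [ijJ|ijJ] := boolP (ij \in J).
  by apply: key; apply: (triv C (~: J)%SET); rewrite inE negbK.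
by rewrite setIC mulrC; apply: key; exact: (triv B J).
Qed.

End masks.

(** Once the two systems of coefficients have disjoint supports, the two
    matrices are linear images of complementary masks. *)
Lemma independent_orthogonal_forms (m n p q p' q' : nat) (sigma : R)
    (X : 'I_m * 'I_n -> T -> R)
    (a : 'I_p -> 'I_q -> 'I_m * 'I_n -> R)
    (b : 'I_p' -> 'I_q' -> 'I_m * 'I_n -> R) :
  sigma != 0 -> iid_normal P sigma X ->
  (forall i j k l, \sum_x a i j x * b k l x = 0) ->
  independent_pair P
    (fun w => \matrix_(i, j) \sum_x a i j x * X x w)
    (fun w => \matrix_(k, l) \sum_x b k l x * X x w).
Proof.
move=> s0 iX ab.
pose c (t : 'I_p * 'I_q + 'I_p' * 'I_q') := match t with
  | inl ij => a ij.1 ij.2 | inr kl => b kl.1 kl.2 end.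
have orth k l : \sum_x c (inl k) x * c (inr l) x = 0 by exact: ab.
have [X' [c' [J [iX' form c'l c'r]]]] := split_orthogonal s0 iX orth.
pose L r s (f : 'I_r -> 'I_s -> 'I_m * 'I_n -> R) (M : 'M[R]_(m, n)) :
    'M[R]_(r, s) :=
  \matrix_(i, j) \sum_x f i j x * M x.1 x.2.
have mL r s f : measurable_fun setT (L r s f).
  apply: measurable_mx => i j; under eq_fun do rewrite mxE.
  apply: measurable_sum => x; apply: measurable_funM => //.
  exact: measurable_mx_entry.
rewrite (_ : (fun w => _) =
    L p q (fun i j => c' (inl (i, j))) \o mask X' J); last first.
  apply/funext => w; apply/matrixP => i j; rewrite !mxE.
  rewrite -(form (inl (i, j))); apply: eq_bigr => -[x y] _; rewrite mxE.
  by case: ifPn => // xJ; rewrite c'l ?mul0r.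
rewrite [X in independent_pair _ _ X](_ : _ =
    L p' q' (fun i j => c' (inr (i, j))) \o mask X' (~: J)); last first.
  apply/funext => w; apply/matrixP => i j; rewrite !mxE.
  rewrite -(form (inr (i, j))); apply: eq_bigr => -[x y] _; rewrite mxE inE.
  by case: ifPn => //; rewrite negbK => xJ; rewrite c'r ?mul0r.
apply: independent_pair_comp; [exact: mL|exact: mL|].
exact: (independent_masks iX' J).
Qed.

End independence.

(** * Normal equations *)
Section least_squares.
Context (R : realType).

Lemma normsq2E (k : nat) (v : 'cV[R]_k) : normsq2 v = (v^T *m v) 0 0.
Proof. by rewrite mxE; apply: eq_bigr => i _; rewrite mxE expr2. Qed.

Lemma normsq2_ge0 (k : nat) (v : 'cV[R]_k) : 0 <= normsq2 v.
Proof. by apply: sumr_ge0 => i _; exact: sqr_ge0. Qed.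

Lemma normsq2_eq0 (k : nat) (v : 'cV[R]_k) : normsq2 v = 0 -> v = 0.
Proof.
move=> /psumr_eq0P v0; apply/colP => i; rewrite mxE; apply/eqP.
by rewrite -sqrf_eq0 v0// => j _; exact: sqr_ge0.
Qed.

Lemma normsq2_line (k : nat) (r h : 'cV[R]_k) (t : R) :
  normsq2 (r - t *: h) =
  normsq2 r - (2 * t) * (r^T *m h) 0 0 + t ^+ 2 * normsq2 h.
Proof.
rewrite [(r^T *m h) _ _]mxE /normsq2 !mulr_sumr -sumrB -big_split/=.
by apply: eq_bigr => i _; rewrite !mxE; ring.
Qed.

(** Along x - t g, where g is the left-hand side, the objective is
    |r|^2 - 2 t |g|^2 + t^2 |M g|^2 with r = M x - b; for g != 0 this is below
    |r|^2 at small t > 0. *)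
Lemma argmin_normal_equations (p q : nat) (M : 'M[R]_(p, q)) (b : 'cV[R]_p)
    (x : 'cV[R]_q) :
  is_argmin (fun z => normsq2 (M *m z - b)) x -> M^T *m (M *m x - b) = 0.
Proof.
move=> xmin; set r := M *m x - b; set g := M^T *m r.
have expand t : normsq2 (M *m (x - t *: g) - b) =
    normsq2 r - (2 * t) * normsq2 g + t ^+ 2 * normsq2 (M *m g).
  have -> : M *m (x - t *: g) - b = r - t *: (M *m g).
    by rewrite mulmxBr -scalemxAr addrAC.
  by rewrite normsq2_line [normsq2 g]normsq2E [in RHS]trmx_mul trmxK mulmxA.
apply: normsq2_eq0; apply/eqP; rewrite eq_le normsq2_ge0 andbT leNgt.
apply/negP => g0; set h := normsq2 (M *m g) in expand.
have h0 : 0 <= h by exact: normsq2_ge0.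
have h1 : 0 < h + 1 by rewrite ltr_wpDl.
(* The + 1 keeps the denominator positive when M g = 0. *)
pose t := normsq2 g / (h + 1).
have := xmin (x - t *: g); rewrite -/r expand; apply/negP; rewrite -ltNge.
have t0 : 0 < t by rewrite divr_gt0.
have tE : t * (h + 1) = normsq2 g by rewrite divfK// gt_eqF.
rewrite -tE; nra.
Qed.

Lemma gram_sym (m d : nat) (M : 'M[R]_(m, d)) : (M^T *m M)^T = M^T *m M.
Proof. by rewrite trmx_mul trmxK. Qed.

Lemma invmx_gram_sym (m d : nat) (M : 'M[R]_(m, d)) :
  (invmx (M^T *m M))^T = invmx (M^T *m M).
Proof. by rewrite trmx_inv gram_sym. Qed.

Lemma sketch_gramE (m n d : nat) (S : 'M[R]_(m, n)) (A : 'M[R]_(n, d)) :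
  sketch_gram S A = (S *m A)^T *m (S *m A).
Proof. by rewrite /sketch_gram trmx_mul !mulmxA. Qed.

Lemma sketch_pinvE (m n d : nat) (S : 'M[R]_(m, n)) (A : 'M[R]_(n, d)) :
  sketch_pinv S A = invmx (sketch_gram S A) *m (S *m A)^T.
Proof. by rewrite /sketch_pinv trmx_mul mulmxA. Qed.

Lemma gram_moore_penrose (m d : nat) (M : 'M[R]_(m, d)) :
  M^T *m M \in unitmx -> is_moore_penrose M (invmx (M^T *m M) *m M^T).
Proof.
move=> Gunit; have XM : invmx (M^T *m M) *m M^T *m M = 1%:M.
  by rewrite -mulmxA mulVmx.
split.
- by rewrite -mulmxA XM mulmx1.
- by rewrite XM mul1mx.
- by rewrite !trmx_mul trmxK invmx_gram_sym mulmxA.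
- by rewrite XM trmx1.
Qed.

Lemma sketched_solution (m n d : nat) (S : 'M[R]_(m, n)) (A : 'M[R]_(n, d))
    (y : 'cV[R]_n) (x z : 'cV[R]_d) :
  sketch_gram S A \in unitmx ->
  is_argmin (fun x : 'cV[R]_d => normsq2 (S *m A *m x - S *m y)) z ->
  z = x + sketch_pinv S A *m (S *m (y - A *m x)).
Proof.
rewrite sketch_pinvE sketch_gramE => Gunit /argmin_normal_equations /eqP.
rewrite mulmxBr subr_eq0 => /eqP zE; set M := S *m A in Gunit zE *.
have SyE : M *m x + S *m (y - A *m x) = S *m y.
  by rewrite mulmxBr /M -mulmxA addrC subrK.
set q := S *m _ in SyE *.
rewrite -[z in LHS](mulKmx Gunit) -[M^T *m M *m z]mulmxA zE -SyE !mulmxDr.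
by rewrite [M^T *m (M *m x)]mulmxA mulKmx// -mulmxA.
Qed.

End least_squares.

(** * Conditional laws *)
Section law_kernel.
Local Open Scope ereal_scope.
Context (R : realType) (d d1 d2 d3 : measure_display) (T : measurableType d)
  (U : measurableType d1) (W : measurableType d2) (V : measurableType d3)
  (P : probability T R).
Variables (Z : {mfun T >-> W}) (phi : U -> W -> V).
Hypothesis mphi : measurable_fun setT (fun z : U * W => phi z.1 z.2).

Let mphiZ (x : U) : measurable_fun setT (fun w => phi x (Z w)).
Proof.
apply: (measurableT_comp (g := fun w => (x, Z w)) mphi).
exact: measurable_fun_pair.
Qed.

Definition law_kernel (x : U) : {measure set V -> \bar R} :=
  image_measure P (mphiZ x).

Lemma law_kernelE (x : U) (B : set V) : measurable B ->
  law_kernel x B =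
  distribution P Z (xsection ((fun z : U * W => phi z.1 z.2) @^-1` B) x).
Proof.
move=> mB; congr (P _); apply/funext => w; rewrite /xsection /=.
by apply/propext; split => [?|]; [exact: mem_set|move/set_mem].
Qed.

Let measurable_law_kernel (B : set V) : measurable B ->
  measurable_fun setT (law_kernel ^~ B).
Proof.
move=> mB; under eq_fun do rewrite law_kernelE//.
apply: measurable_fun_xsection; rewrite -[_ @^-1` _]setTI; exact: mphi.
Qed.

HB.instance Definition _ :=
  isKernel.Build _ _ U V R law_kernel measurable_law_kernel.

Let law_kernelT (x : U) : law_kernel x setT = 1.
Proof. exact: probability_setT. Qed.

HB.instance Definition _ :=
  Kernel_isProbability.Build _ _ U V R law_kernel law_kernelT.

(** The law of (X, Z) is the product of the laws of X and Z, so this is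
    Tonelli's theorem: integrate first over Z with X frozen. *)
Lemma independent_regular_cond_distribution (X : {mfun T >-> U}) :
  independent_pair P X Z ->
  regular_cond_distribution P (fun w => phi (X w) (Z w)) X law_kernel.
Proof.
move=> XZ E B mE mB.
pose C := (E `*` setT) `&` ((fun z : U * W => phi z.1 z.2) @^-1` B).
have mphiB : measurable ((fun z : U * W => phi z.1 z.2) @^-1` B).
  by rewrite -[_ @^-1` _]setTI; exact: mphi.
have mC : measurable C by apply: measurableI => //; exact: measurableX.
have joint := @pair_law_product _ _ _ T U W R P (distribution P X)
  (distribution P Z) X Z setT.
transitivity (P ((fun w => (X w, Z w)) @^-1` C `&` setT)).
  congr (P _); rewrite setIT; apply/funext => w /=.
  by apply/propext; split => [[]|[[]]].
rewrite joint//; last by move=> A D mA mD; rewrite setIT; exact: XZ.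
transitivity (\int[distribution P X]_(x in E) law_kernel x B).
  rewrite [RHS]integral_mkcond; apply: eq_integral => x _.
  rewrite patchE /=; case: ifPn => xE.
    rewrite law_kernelE//; congr (distribution P Z _).
    apply/funext => z; rewrite /xsection /=; apply/propext.
    split => /set_mem h; apply/mem_set; first by case: h.
    by split=> //; split => //=; exact: set_mem.
  rewrite (_ : xsection _ _ = set0) ?measure0//.
  apply/seteqP; split => z //; rewrite /xsection /= => /set_mem[[/= xE' _] _].
  by move: xE; rewrite notin_setE.
rewrite ge0_integral_pushforward//.
by apply: measurable_funTS; exact: measurable_law_kernel.
Qed.

End law_kernel.

Lemma regular_cond_distribution_ae (R : realType) (d d1 d2 : measure_display)
    (T : measurableType d) (P : probability T R) (U : measurableType d1)
    (V : measurableType d2) (X : T -> U) (Y Y' : T -> V)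
    (kappa : R.-pker U ~> V) :
  measurable_fun setT X -> measurable_fun setT Y -> measurable_fun setT Y' ->
  {ae P, forall w, Y w = Y' w} ->
  regular_cond_distribution P Y' X kappa ->
  regular_cond_distribution P Y X kappa.
Proof.
move=> mX mY mY' [N [mN PN YN]] kY' E B mE mB; rewrite -kY'//.
have mpre d3 (W : measurableType d3) (f : T -> W) (C : set W) :
    measurable_fun setT f -> measurable C -> measurable (f @^-1` C).
  by move=> mf mC; rewrite -[_ @^-1` _]setTI; exact: mf.
have null F : measurable F -> P F = P (F `\` N).
  move=> mF; rewrite [LHS](measureDI P mF mN).
  rewrite [X in (_ + X)%E](_ : _ = 0%E) ?adde0//.
  apply/eqP; rewrite eq_le measure_ge0 andbT -PN.
  by apply: le_measure; rewrite ?inE//; exact: measurableI.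
rewrite null; last by apply: measurableI; exact: mpre.
rewrite [RHS]null; last by apply: measurableI; exact: mpre.
congr (P _); apply/seteqP; split => w [[/= wE wB] wN]; (split; [split|]) => //=.
  by rewrite -(_ : Y w = Y' w)//; apply: contrapT => h; exact/wN/YN.
by rewrite (_ : Y w = Y' w)//; apply: contrapT => h; exact/wN/YN.
Qed.

(** * Linear images of a Gaussian matrix *)
Section gaussian_matrix.
Context (R : realType) (d : measure_display) (T : measurableType d)
  (P : probability T R) (m n : nat) (S : {RV P >-> 'M[R]_(m, n)}) (v : R).
Hypotheses (v0 : 0 < v) (S_iid : iid_gaussian_entries P S v).

Lemma iid_gaussian_entries_normal :
  iid_normal P (Num.sqrt v) (fun (ij : 'I_m * 'I_n) w => S w ij.1 ij.2).
Proof.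
have [Sind Slaw] := S_iid; split.
  by move=> ij; apply: measurable_entry; exact: measurable_funPT.
move=> B mB; rewrite (Sind B mB); congr (_%:E); apply: eq_bigr => ij _.
by congr fine; exact: Slaw.
Qed.

Lemma measurable_sketch (p : nat) (B : 'M[R]_(n, p)) :
  measurable_fun setT (fun w => S w *m B).
Proof. by apply: measurable_mulmx => //; exact: measurable_cst. Qed.

(** u^T S z is the linear form in the entries of S with coefficients u_i z_j,
    and sum_ij (u_i z_j)^2 = |u|^2 |z|^2. *)
Lemma sketch_form_law (u : 'cV[R]_m) (z : 'cV[R]_n) (b : R) (B : set R) :
  measurable B ->
  P [set w | B (b + (u^T *m (S w *m z)) 0 0)] =
  normal_law b (v * (normsq2 u * normsq2 z)) B.
Proof.
move=> mB.
have -> : normsq2 u * normsq2 z =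
    \sum_(ij : 'I_m * 'I_n) (u ij.1 0 * z ij.2 0) ^+ 2.
  rewrite -(pair_bigA _ (fun i j => (u i 0 * z j 0) ^+ 2))/= /normsq2 mulr_suml.
  apply: eq_bigr => i _; rewrite mulr_sumr; apply: eq_bigr => j _.
  by rewrite exprMn.
rewrite -(linear_form_law _ b v0 iid_gaussian_entries_normal mB).
congr (P _); apply/funext => w /=; congr (B (b + _)).
rewrite -(pair_bigA _ (fun i j => u i 0 * z j 0 * S w i j))/= mxE.
apply: eq_bigr => i _; rewrite !mxE mulr_sumr; apply: eq_bigr => j _.
by rewrite mulrAC mulrA.
Qed.

Lemma sketch_gaussian_vector (z : 'cV[R]_n) :
  gaussian_vector P (fun w => S w *m z).
Proof.
split; first exact: measurable_sketch.
have varE (u : 'cV[R]_m) :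
    (u^T *m (v * normsq2 z)%:M *m u) 0 0 = v * (normsq2 u * normsq2 z).
  by rewrite mul_mx_scalar -scalemxAl mxE -normsq2E; ring.
exists 0, (v * normsq2 z)%:M; split.
- by rewrite tr_scalar_mx.
- by move=> u; rewrite varE !mulr_ge0 ?normsq2_ge0// ltW.
- move=> u B mB; rewrite varE mulmx0 mxE -sketch_form_law//.
  by congr (P _); apply/funext => w /=; rewrite add0r.
Qed.

(** Entry (i, j) of S B has coefficient vector supported on row i, where it is
    column j of B. Entries in different rows thus have orthogonal
    coefficients, and entries in the same row have for scalar product an entry
    of C^T B. *)
Lemma sketch_independent (p q : nat) (B : 'M[R]_(n, p)) (C : 'M[R]_(n, q)) :
  C^T *m B = 0 ->
  independent_pair P (fun w => S w *m B) (fun w => S w *m C).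
Proof.
move=> CB0.
pose coef r (D : 'M[R]_(n, r)) (i : 'I_m) (j : 'I_r) (x : 'I_m * 'I_n) : R :=
  (i == x.1)%:R * D x.2 j.
have coefE r (D : 'M[R]_(n, r)) : (fun w => S w *m D) =
    (fun w => \matrix_(i, j) \sum_x coef r D i j x * S w x.1 x.2).
  apply/funext => w; apply/matrixP => i j; rewrite !mxE.
  rewrite -(pair_bigA _ (fun k l => coef r D i j (k, l) * S w k l))/=.
  rewrite (bigD1 i)//= [X in _ + X]big1 ?addr0 => [|k ki]; last first.
    by apply: big1 => l _; rewrite /coef /= eq_sym (negbTE ki) !mul0r.
  by apply: eq_bigr => l _; rewrite /coef /= eqxx mul1r mulrC.
rewrite !coefE.
apply: (independent_orthogonal_forms _ iid_gaussian_entries_normal).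
  by rewrite sqrtr_eq0 -ltNge.
move=> i j k l.
rewrite -(pair_bigA _ (fun a b => coef p B i j (a, b) * coef q C k l (a, b)))/=.
apply: big1 => a _; rewrite /coef /=.
transitivity ((i == a)%:R * (k == a)%:R * (C^T *m B) l j).
  by rewrite mxE mulr_sumr; apply: eq_bigr => b _; rewrite !mxE; ring.
by rewrite CB0 mxE mulr0.
Qed.

End gaussian_matrix.

Section sketched_residual.
Context (R : realType) (d : measure_display) (T : measurableType d)
  (P : probability T R) (m n p : nat) (S : {RV P >-> 'M[R]_(m, n)}) (v : R).
Hypotheses (v0 : 0 < v) (S_iid : iid_gaussian_entries P S v).

(** x + (M^T M)^-1 M^T z for an invertible Gram matrix. The quotient of the
    adjugate by the determinant is a measurable function of M without case
    distinction. *)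
Definition shifted_pinv (x : 'cV[R]_p) (M : 'M[R]_(m, p)) (z : 'cV[R]_m) :
    'cV[R]_p :=
  x + (\det (M^T *m M))^-1 *: (\adj (M^T *m M) *m (M^T *m z)).

Lemma shifted_pinvE x (M : 'M[R]_(m, p)) z : M^T *m M \in unitmx ->
  shifted_pinv x M z = x + invmx (M^T *m M) *m M^T *m z.
Proof. by move=> Gu; rewrite /shifted_pinv /invmx Gu scalemxAl mulmxA. Qed.

Lemma measurable_shifted_pinv x :
  measurable_fun setT
    (fun Mz : 'M[R]_(m, p) * 'cV[R]_m => shifted_pinv x Mz.1 Mz.2).
Proof.
have mG : measurable_fun setT
    (fun Mz : 'M[R]_(m, p) * 'cV[R]_m => Mz.1^T *m Mz.1).
  by apply: measurable_mulmx => //; exact: measurable_trmx.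
apply: measurable_mx => i j; under eq_fun do rewrite mxE [X in _ + X]mxE.
apply: measurable_funD => //; apply: measurable_funM.
  by apply: (measurableT_comp (@measurable_inv R)); exact: measurable_det.
apply: measurable_entry; apply: measurable_mulmx; first exact: measurable_adj.
by apply: measurable_mulmx => //; exact: measurable_trmx.
Qed.

(** With G = M^T M, the functional u^T of the random part is the form with left
    vector M G^-1 u, of squared norm u^T G^-1 G G^-1 u = u^T G^-1 u. *)
Lemma shifted_pinv_law (x : 'cV[R]_p) (M : 'M[R]_(m, p)) (z : 'cV[R]_n) :
  M^T *m M \in unitmx ->
  gaussian_law x ((v * normsq2 z) *: invmx (M^T *m M))
    (fun B => P [set w | B (shifted_pinv x M (S w *m z))]).
Proof.
move=> Gu; set G := M^T *m M in Gu *.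
have varE (u : 'cV[R]_p) : (u^T *m ((v * normsq2 z) *: invmx G) *m u) 0 0 =
    v * (normsq2 (M *m (invmx G *m u)) * normsq2 z).
  rewrite -scalemxAr -scalemxAl mxE [normsq2 (M *m _)]normsq2E.
  have -> : (M *m (invmx G *m u))^T *m (M *m (invmx G *m u)) =
      u^T *m invmx G *m u.
    rewrite !trmx_mul invmx_gram_sym -!mulmxA; congr (_ *m (_ *m _)).
    by rewrite (mulmxA M^T) mulKVmx.
  by ring.
split.
- by rewrite linearZ /= invmx_gram_sym.
- by move=> u; rewrite varE !mulr_ge0 ?normsq2_ge0// ltW.
- move=> u B mB; rewrite varE -(sketch_form_law v0 S_iid)//.
  congr (P _); apply/funext => w /=; rewrite shifted_pinvE//.
  rewrite mulmxDr mxE !trmx_mul invmx_gram_sym; congr (B (_ + _)).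
  by rewrite !mulmxA.
Qed.

End sketched_residual.

Theorem lemma1 (R : realType) (d0 : measure_display) (T : measurableType d0)
    (P : probability T R) (n d m : nat)
    (d_ge1 : (1 <= d)%N) (d_lt_n : (d < n)%N) (m_ge1 : (1 <= m)%N)
    (A : 'M[R]_(n, d)) (rankA : \rank A = d) (y : 'cV[R]_n)
    (xLS : 'cV[R]_d)
    (xLS_argmin : is_argmin (fun x : 'cV[R]_d => normsq2 (A *m x - y)) xLS)
    (yperp : 'cV[R]_n) (yperpE : yperp = y - A *m xLS)
    (S : {RV P >-> 'M[R]_(m, n)})
    (S_iid : iid_gaussian_entries P S m%:R^-1)
    (gram_inv : {ae P, forall w, sketch_gram (S w) A \in unitmx})
    (xhat : {RV P >-> 'cV[R]_d})
    (xhat_argmin : forall w, sketch_gram (S w) A \in unitmx ->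
       is_argmin (fun x : 'cV[R]_d => normsq2 (S w *m A *m x - S w *m y))
         (xhat w)) :
  [/\ A^T *m yperp = 0,
      forall w, sketch_gram (S w) A \in unitmx ->
        is_moore_penrose (S w *m A) (sketch_pinv (S w) A) /\
        xhat w = xLS + sketch_pinv (S w) A *m (S w *m yperp),
      gaussian_vector P (fun w => S w *m yperp) /\
        (forall j : 'I_d, gaussian_vector P (fun w => col j (S w *m A))),
      independent_pair P (fun w => S w *m yperp) (fun w => S w *m A) &
      cond_gaussian P xhat (fun w => S w *m A)
        (fun=> xLS)
        (fun w => (m%:R^-1 * normsq2 yperp) *: invmx (sketch_gram (S w) A))].
Proof.
have v0 : 0 < m%:R^-1 :> R by rewrite invr_gt0 ltr0n.
have Ayperp : A^T *m yperp = 0.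
  apply/eqP; rewrite yperpE -oppr_eq0 -mulmxN opprB.
  by apply/eqP; exact: argmin_normal_equations.
have xhatE w : sketch_gram (S w) A \in unitmx ->
    xhat w = xLS + sketch_pinv (S w) A *m (S w *m yperp).
  by move=> Gu; rewrite yperpE; exact: sketched_solution (xhat_argmin w Gu).
split.
- exact: Ayperp.
- move=> w Gu; split; last exact: xhatE.
  by move: Gu; rewrite sketch_pinvE sketch_gramE; exact: gram_moore_penrose.
- split; first exact: sketch_gaussian_vector S_iid _.
  move=> j; under eq_fun do rewrite colE -mulmxA.
  exact: sketch_gaussian_vector S_iid _.
- exact: (sketch_independent v0 S_iid).
have mSA := measurable_sketch S A; have mSy := measurable_sketch S yperp.
pose X : {mfun T >-> 'M[R]_(m, d)} := mfun_Sub (mem_set mSA).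
pose Z : {mfun T >-> 'cV[R]_m} := mfun_Sub (mem_set mSy).
exists (law_kernel P Z (@measurable_shifted_pinv R m d xLS)).
  have XZ : independent_pair P X Z.
    apply: (sketch_independent v0 S_iid).
    by rewrite -[LHS]trmxK trmx_mul trmxK Ayperp trmx0.
  have := independent_regular_cond_distribution
    (@measurable_shifted_pinv R m d xLS) XZ.
  apply: regular_cond_distribution_ae => //.
  - have mXZ : measurable_fun setT (fun w => (X w, Z w)).
      exact: measurable_fun_pair.
    exact: measurableT_comp (@measurable_shifted_pinv R m d xLS) mXZ.
  - apply: filterS gram_inv => w Gu; rewrite xhatE// shifted_pinvE.
      by rewrite sketch_pinvE sketch_gramE.
    by rewrite -sketch_gramE.
apply: filterS gram_inv => w Gu; rewrite sketch_gramE.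
by apply: (shifted_pinv_law v0 S_iid); rewrite -sketch_gramE.
Qed.
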